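(* Suppose $f\colon S\to S$ is any homeomorphism of a connected surface $S$. If there exists $x\in\mathrm{Ends}(S)$ whose orbit under the induced action of $\langle f\rangle$ on $\mathrm{Ends}(S)$ is dense, i.e. $\overline{\langle f\rangle\cdot x}=\mathrm{Ends}(S)$, then the mapping torus $M_f$ has exactly one end.
   Context: $\mathrm{Ends}(X)$ denotes the (Freudenthal) space of ends of a manifold $X$. A homeomorphism $f\colon S\to S$ induces a homeomorphism $f_*\colon\mathrm{Ends}(S)\to\mathrm{Ends}(S)$, and $\langle f\rangle$ acts on $\mathrm{Ends}(S)$ through $f_*$. The mapping torus of $f$ is $M_f=S\times[0,1]/\big((x,1)\sim(f(x),0)\big)$. *)

(* Defs.v *)
From HB Require Import structures.
From Stdlib Require Import Relations.
From mathcomp Require Import all_boot all_order all_algebra.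
From mathcomp Require Import all_classical all_reals.
From mathcomp Require Import topology normedtype.
Import Order.TTheory GRing.Theory Num.Theory.
Import numFieldNormedType.Exports.

Set Implicit Arguments.
Unset Strict Implicit.
Unset Printing Implicit Defensive.

Local Open Scope classical_set_scope.
Local Open Scope ring_scope.
Local Open Scope quotient_scope.

Record homeo (X Y : topologicalType) := Homeo {
  homeo_fun :> X -> Y;
  homeo_inv : Y -> X;
  homeoK : cancel homeo_fun homeo_inv;
  homeoVK : cancel homeo_inv homeo_fun;
  homeo_continuous : continuous homeo_fun;
  homeo_inv_continuous : continuous homeo_inv }.

Definition homeo_sym (X Y : topologicalType) (h : homeo X Y) : homeo Y X :=
  Homeo (homeoVK h) (homeoK h) (homeo_inv_continuous (h := h))
    (homeo_continuous (h := h)).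

Definition homeo_iter (X : topologicalType) (h : homeo X X) (n : int) : X -> X :=
  match n with
  | Posz k => iter k h
  | Negz k => iter k.+1 (homeo_inv h)
  end.

Definition homeo_orbit (X : topologicalType) (h : homeo X X) (x : X) : set X :=
  range (fun n : int => homeo_iter h n x).

(* A boundary is allowed (and may be empty): charts take values in open subsets
   of the closed half-plane. *)
Definition half_plane {R : realType} : set (R * R) := [set p | 0 <= p.2].

Definition surface (R : realType) (S : topologicalType) : Prop :=
  [/\ hausdorff_space S, @second_countable S &
      forall x : S, exists (U : set S) (W : set (R * R)),
        [/\ open U, U x, open W & inhabited (homeo U (W `&` half_plane))]].

Definition compacts (X : topologicalType) : choiceType := set_type (@compact X).

Definition complement_components (X : topologicalType) (K : set X) :
  set (set X) := connected_component (~` K) @` (~` K).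

(* The inverse limit of the spaces pi_0 (X \ K) over all compact sets K ordered
   by inclusion, as a subspace of a product of discrete spaces: for X a manifold,
   X \ K is locally connected, so the quotient topology of pi_0 (X \ K) is
   discrete.  An end picks only components that are not relatively compact. *)
Definition ends_set (X : topologicalType) :
    set (prod_topology (fun K : compacts X => discrete_topology (set X))) :=
  [set e | (forall K, complement_components (val K) (e K)) /\
           (forall K L, val K `<=` val L -> e L `<=` e K)].

Definition ends (X : topologicalType) : topologicalType := @ends_set X.

Lemma near_ends (X : topologicalType) (e : ends X) (K : compacts X) :
  \forall e' \near e, val e' K = val e K.
Proof.
have ce : {for e, continuous (val : ends X -> prod_topology _)}.
  exact: initial_continuous.
have cK := @proj_continuous _ (fun=> discrete_topology (set X)) K (val e).
exact: ce _ (cK _ (discrete_set1 _)).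
Qed.

Section ends_map.
Variables (X Y : topologicalType) (f : homeo X Y).

Lemma homeo_preimage_compact (K : set Y) : compact K -> compact (f @^-1` K).
Proof.
move=> cK; suff -> : f @^-1` K = homeo_inv f @` K.
  apply: continuous_compact => //; apply: continuous_subspaceT.
  exact: homeo_inv_continuous.
apply/seteqP; split=> [x Kx|_ [y Ky <-]] /=; last by rewrite homeoVK.
by exists (f x) => //; rewrite homeoK.
Qed.

Definition compacts_preimage (K : compacts Y) : compacts X :=
  exist _ (f @^-1` val K) (mem_set (homeo_preimage_compact (set_mem (valP K)))).

Lemma homeo_image_connected_component (A : set X) (x : X) :
  f @` connected_component A x = connected_component (f @` A) (f x).
Proof.
have conn (V W : topologicalType) (g : homeo V W) (C : set V) :
    connected C -> connected (g @` C).
  move=> cC; apply: connected_continuous_connected => //.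
  by apply: continuous_subspaceT; exact: homeo_continuous.
apply/seteqP; split.
  move=> _ [y [C [Cx CA cC] Cy] <-]; exists (f @` C); last by exists y.
  by split; [exists x|exact: image_subset|exact: conn].
move=> y [C [Cx CA cC] Cy]; exists (homeo_inv f y); last exact: homeoVK.
exists (homeo_inv f @` C); last by exists y.
split; [by exists (f x) => //; rewrite homeoK| |exact: (conn _ _ (homeo_sym f))].
by move=> _ [z /CA[t At <-] <-]; rewrite homeoK.
Qed.

Lemma ends_map_subproof (e : ends X) :
  ends_set (fun K : compacts Y => f @` (val e (compacts_preimage K))).
Proof.
have [ec em] := set_mem (valP e); split=> [K|K L KL].
  have [x Kx <-] := ec (compacts_preimage K).
  exists (f x); first by [].
  rewrite homeo_image_connected_component; congr (connected_component _ _).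
  apply/seteqP; split=> [y Ky|_ [y Ky <-]] //=.
  by exists (homeo_inv f y); [rewrite /= homeoVK|rewrite homeoVK].
by apply: image_subset; apply: em => x /=; exact: KL.
Qed.

(* f_* e assigns to K the image under f of the component e assigns to the
   preimage of K. *)
Definition ends_map (e : ends X) : ends Y :=
  exist (fun g => g \in @ends_set Y) _ (mem_set (ends_map_subproof e)).

Lemma ends_map_continuous : continuous ends_map.
Proof.
apply: continuous_comp_initial => e.
have FF : Filter ((set_val \o ends_map) @ e).
  exact: (fmap_filter _ (@nbhs_filter (ends X) e)).
apply/cvg_sup => K U.
rewrite nbhsE => -[_ [[B _ <-] Be] BU].
move: (near_ends e (compacts_preimage K)); apply: filterS => e' ee'.
apply: BU; suff E : f @` val e' (compacts_preimage K) =
    f @` val e (compacts_preimage K) by exact: (eq_ind_r B Be E).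
by rewrite ee'.
Qed.

End ends_map.

Lemma ends_mapK (X Y : topologicalType) (f : homeo X Y) (g : homeo Y X) :
  cancel f g -> cancel (ends_map f) (ends_map g).
Proof.
move=> fK e; apply: val_inj; apply: functional_extensionality_dep => K /=.
rewrite image_comp (_ : g \o f = id) ?image_id; last exact/funext.
congr (val e _); apply: val_inj; rewrite /= -comp_preimage.
by rewrite (_ : g \o f = id) //; exact/funext.
Qed.

Definition ends_homeo (X Y : topologicalType) (f : homeo X Y) :
    homeo (ends X) (ends Y) :=
  Homeo (ends_mapK (f := f) (g := homeo_sym f) (homeoK f))
    (ends_mapK (f := homeo_sym f) (g := f) (homeoVK f))
    (ends_map_continuous (f := f)) (ends_map_continuous (f := homeo_sym f)).

Section mapping_torus.
Variables (R : realType) (S : topologicalType) (f : S -> S).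

Definition unit_interval : topologicalType := (`[0, 1]%classic : set R).

Definition cylinder : topologicalType := (S * unit_interval)%type.

Definition mapping_torus_glue (p q : cylinder) : Prop :=
  [/\ set_val p.2 = 1, set_val q.2 = 0 & q.1 = f p.1].

(* The equivalence relation generated by (x, 1) ~ (f x, 0). *)
Definition mapping_torus_rel (p q : cylinder) : bool :=
  `[< clos_refl_sym_trans cylinder mapping_torus_glue p q >].

Lemma mapping_torus_rel_refl : reflexive mapping_torus_rel.
Proof. by move=> p; apply/asboolP; exact: rst_refl. Qed.

Lemma mapping_torus_rel_sym : symmetric mapping_torus_rel.
Proof. by move=> p q; apply/asboolP/asboolP => ?; exact: rst_sym. Qed.

Lemma mapping_torus_rel_trans : transitive mapping_torus_rel.
Proof.
by move=> q p r /asboolP pq /asboolP qr; apply/asboolP; exact: rst_trans qr.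
Qed.

Definition mapping_torus_equiv : equiv_rel cylinder :=
  EquivRel mapping_torus_rel mapping_torus_rel_refl mapping_torus_rel_sym
    mapping_torus_rel_trans.

Definition mapping_torus : topologicalType :=
  quotient_topology {eq_quot mapping_torus_equiv}.

End mapping_torus.

(* Main.v *)
Require Import Defs.
From Stdlib Require Import Relations.
From mathcomp Require Import all_boot all_order all_algebra.
From mathcomp Require Import all_classical all_reals topology normedtype.
From mathcomp Require Import lra.
Import Order.TTheory GRing.Theory Num.Theory.
Import numFieldNormedType.Exports.

Set Implicit Arguments.
Unset Strict Implicit.
Unset Printing Implicit Defensive.

Local Open Scope ring_scope.
Local Open Scope classical_set_scope.

(* For a compact K in the torus choose a compact L in S outside which the whole
   fibres {y} x [0, 1] miss K.  An end z of S then selects the component of the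
   complement of K containing the connected set z(L) x [0, 1]; it is independent
   of L, locally constant in z, and the same for z and f_* z, because (y, 1) and
   (f y, 0) are glued.  Hence it is constant on the closure of an orbit.  Every
   end e of the torus is selected by some z at K: the projections to S of the
   sets e(K') form a filter base avoiding every compact set, and an ultrafilter
   refining it contains exactly one component of the complement of each compact
   subset of S, which defines z. *)

(** * Compactness induction and connected products *)

Lemma compact_local_ind (X : topologicalType) (P : set X -> Prop) (A : set X) :
  compact A -> P set0 ->
  (forall B C, B `<=` C -> P C -> P B) ->
  (forall B C, P B -> P C -> P (B `|` C)) ->
  (forall x, A x -> exists2 B, nbhs x B & P B) -> P A.
Proof.
move=> /compact_near_coveringP cA P0 Psub PU Ploc.
(* Closure under unions makes the families of supersets of members of [P] generate a filter;
   near-covering compactness along it puts [A] inside one member. *)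
pose F := filter_from P (fun B => [set C | B `<=` C]).
have FF : Filter F.
  apply: filter_from_filter; first by exists set0.
  move=> B C PB PC; exists (B `|` C); first exact: PU.
  by move=> D /=; rewrite subUset.
have [|B PB /(_ B (@subset_refl _ _)) AB] := cA _ F (fun C x => C x) FF.
  move=> x /Ploc[B Bx PB]; exists (B, [set C | B `<=` C]) => /=.
    by split=> //; exists B.
  by move=> [y C] /= [By BC]; exact: BC.
exact: Psub AB PB.
Qed.

Lemma connected_setX (X Y : topologicalType) (A : set X) (B : set Y) :
  connected A -> connected B -> connected (A `*` B).
Proof.
move=> cA cB; have [->|/set0P[b Bb]] := eqVneq B set0.
  by rewrite setX0; exact: connected0.
have [->|/set0P[a0 Aa0]] := eqVneq A set0.
  by rewrite set0X; exact: connected0.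
(* Crosses: each is connected through [(a, b)], and all contain [(a0, b)]. *)
have -> : A `*` B =
    \bigcup_(a in A) ((pair^~ b @` A) `|` (pair a @` B)).
  apply/seteqP; split=> [[x y] [/= Ax By]|_ [a Aa [[x Ax <-]|[y By <-]]]] //.
  by exists x => //; right; exists y.
have cl y : connected (pair^~ y @` A).
  apply: connected_continuous_connected => //; apply: continuous_subspaceT.
  by move=> x; apply: cvg_pair => /=; [exact: cvg_id|exact: cvg_cst].
have cr x : connected (pair x @` B).
  apply: connected_continuous_connected => //; apply: continuous_subspaceT.
  by move=> y; apply: cvg_pair => /=; [exact: cvg_cst|exact: cvg_id].
apply: bigcup_connected => [|a Aa].
  by exists (a0, b) => a Aa; left; exists a0.
by apply: connectedU => //; exists (a, b); split; [exists a|exists b].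
Qed.

Lemma connected_component_subset (X : topologicalType) (A C : set X) (x : X) :
  connected C -> C `<=` A -> connected_component A x `&` C !=set0 ->
  C `<=` connected_component A x.
Proof.
move=> cC CA [y [xy Cy]].
by rewrite (same_connected_component xy); exact: connected_component_max.
Qed.

(** * Compact connected neighbourhoods in surfaces *)

Definition locally_compact_connected (X : topologicalType) :=
  forall (x : X) (V : set X), nbhs x V ->
  exists K, [/\ nbhs x K, compact K, connected K & K `<=` V].

(** Only the trace of [N] has to lie in [B], because the half-plane carries the subspace
    topology. *)
Lemma half_plane_compact_connected_nbhs (R : realType) (p : R * R)
    (V : set (R * R)) : half_plane p -> nbhs p V ->
  exists N B, [/\ nbhs p N, N `&` half_plane `<=` B,
    compact B, connected B & B `<=` V `&` half_plane].
Proof.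
move=> p0 [[V1 V2] /= [V1p V2p] VV].
have seg (a : R) (W : set R) : nbhs a W -> exists2 e : R, 0 < e &
    `[(a - e)%R, (a + e)%R]%classic `<=` W.
  move=> /nbhs_ballP[e /= e0 eW]; exists (e / 2)%R; first by lra.
  move=> y /=; rewrite in_itv/= => /andP[y1 y2]; apply: eW.
  by rewrite /ball/= ltr_norml; apply/andP; split; lra.
have [e e0 eV] := seg _ _ V1p; have [d d0 dV] := seg _ _ V2p.
(* Cutting the lower edge at the boundary line keeps the trace a product of segments. *)
pose c := Order.max 0%R (p.2 - d)%R.
exists (ball p.1 e `*` ball p.2 d),
  (`[p.1 - e, p.1 + e]%classic `*` `[c, p.2 + d]%classic)%R.
split.
- by exists (ball p.1 e, ball p.2 d) => //=; split; exact: nbhsx_ballx.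
- move=> [x y] /= [[]]; rewrite /ball/= !ltr_norml => /andP[x1 x2] /andP[y1 y2].
  rewrite /half_plane/= => y0; rewrite !in_itv/= ge_max y0/=.
  by split; [|apply/andP; split]; try (apply/andP; split); lra.
- by apply: compact_setX; exact: segment_compact.
- by apply: connected_setX; exact: segment_connected.
move=> [x y] [/= xe]; rewrite in_itv/= ge_max => /andP[/andP[y0 y1] y2].
split=> //; apply: VV; split=> /=; first exact: eV.
by apply: dV; rewrite /= in_itv/= y1.
Qed.

Lemma surface_locally_compact_connected (R : realType) (S : topologicalType) :
  surface R S -> locally_compact_connected S.
Proof.
move=> [_ _ chart] x V Vx.
have [U [W [oU Ux oW [h]]]] := chart x.
pose D := W `&` half_plane.
have valU : continuous (set_val : U -> S) by exact: initial_continuous.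
have valD : continuous (set_val : D -> R * R) by exact: initial_continuous.
pose u : U := exist _ x (mem_set Ux).
(* The inverse chart, extended by the default value [x] off [D], so that it applies to subsets of
   the plane. *)
pose g := 'valL_x (set_val \o homeo_inv h) : R * R -> S.
have gE (w : D) : g (set_val w) = set_val (homeo_inv h w).
  exact: (congr1 (@^~ w) (valLK x (set_val \o homeo_inv h))).
have cg : {within D, continuous g}.
  apply/subspace_valL_continuousP' => w.
  apply: continuous_comp; [exact: homeo_inv_continuous|exact: valU].
have [Wp Hp] : D (set_val (h u)) := set_valP (h u).
have [O [oO Op OV]] : exists O : set (R * R), [/\ open O, O (set_val (h u)) &
    forall w : D, O (set_val w) -> V (g (set_val w))].
  have : nbhs (h u) ((set_val \o homeo_inv h) @^-1` V).
    apply: (@continuous_comp _ _ _ (homeo_inv h) set_val).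
    - exact: homeo_inv_continuous.
    - exact: valU.
    - by rewrite /= homeoK.
  move=> [_ [[O oO <-] Op] OV]; exists O; split=> // w Ow.
  by rewrite gE; exact: OV.
have [N [B [Np NB cB kB BV]]] : exists N B, [/\ nbhs (set_val (h u)) N,
    N `&` half_plane `<=` B, compact B, connected B &
    B `<=` (O `&` W) `&` half_plane].
  apply: half_plane_compact_connected_nbhs => //; apply: filterI.
    exact: open_nbhs_nbhs.
  exact: open_nbhs_nbhs.
have BD : B `<=` D by move=> b /BV[[]].
have cgB := continuous_subspaceW BD cg.
exists (g @` B); split.
(* A neighbourhood of [u] in the subtype [U] yields one of [x] in [S], because [U] is open. *)
- have : nbhs u ((set_val \o h) @^-1` N).
    apply: (@continuous_comp _ _ _ h set_val) Np.
    - exact: homeo_continuous.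
    - exact: valD.
  move=> [_ [[O' oO' <-] O'x] O'N].
  have : nbhs x (O' `&` U) by apply: filterI; exact: open_nbhs_nbhs.
  apply: filterS => y [O'y Uy]; pose v : U := exist _ y (mem_set Uy).
  exists (set_val (h v)); last by rewrite gE homeoK.
  apply: NB; split; first exact: (O'N v).
  by have [] := set_valP (h v).
- exact: continuous_compact.
- exact: connected_continuous_connected.
- move=> _ [b Bb <-]; have [[Ob _] _] := BV _ Bb.
  exact: (OV (exist _ b (mem_set (BD _ Bb)))).
Qed.

(** * Open components, and ends defined by ultrafilters *)

Lemma connected_component_open (X : topologicalType) (A : set X) (x : X) :
  locally_compact_connected X -> open A -> open (connected_component A x).
Proof.
move=> lX oA; rewrite openE => y Cy.
have Ay := connected_component_sub Cy.
have [K [Ky _ cK KA]] := lX _ _ (open_nbhs_nbhs (conj oA Ay)).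
have Ky1 := nbhs_singleton Ky; apply: filterS Ky.
by apply: connected_component_subset => //; exists y.
Qed.

Lemma compact_nbhs_compact (X : topologicalType) (A : set X) :
  locally_compact_connected X -> compact A ->
  exists2 K, compact K & A `<=` K^°.
Proof.
move=> lX cA.
apply: (compact_local_ind
  (P := fun A => exists2 K, compact K & A `<=` K^°) cA).
- by exists set0; [exact: compact0|].
- by move=> B C BC [K cK CK]; exists K => //; exact: subset_trans CK.
- move=> B C [K cK BK] [L cL CL]; exists (K `|` L); first exact: compactU.
  rewrite subUset; split.
    by apply: subset_trans BK _; apply: interiorS; exact: subsetUl.
  by apply: subset_trans CL _; apply: interiorS; exact: subsetUr.
- move=> x _; have [K [Kx cK _ _]] := lX x setT filterT.
  by exists K^°; [exact: nbhs_interior|exists K].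
Qed.

(* If L is a compact neighbourhood of K, a component of ~` K missing the
   frontier of L either lies in L or is clopen; the frontier meets only
   finitely many components, so one of them belongs to G. *)
Lemma ultra_component (X : topologicalType) (G : set_system X) (K : set X) :
  hausdorff_space X -> locally_compact_connected X -> connected [set: X] ->
  UltraFilter G -> (forall L, compact L -> G (~` L)) -> compact K ->
  exists2 x, ~ K x & G (connected_component (~` K) x).
Proof.
move=> hX lX cX GU Gco cK; have GF := @ultra_proper _ _ GU.
apply: contrapT => nG.
have oK : open (~` K) by apply: closed_openC; exact: compact_closed.
have [L cL KL] := compact_nbhs_compact lX cK.
have cF : compact (L `\` L^°).
  by apply: compact_closedI => //; apply: open_closedC; exact: open_interior.
(* Assuming that no component lies in [G], compactness induction shows that [G]-most points have a
   component missing the frontier of [L]. *)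
pose P B := G [set y | connected_component (~` K) y `&` B = set0].
have PF : P (L `\` L^°).
  apply: (compact_local_ind (P := P) cF).
  - by rewrite /P; apply: (filterS _ filterT) => y _ /=; rewrite setI0.
  - move=> B C BC; rewrite /P; apply: filterS => y /=.
    by rewrite -!subset0; apply: subset_trans; exact: setIS.
  - move=> B C; rewrite /P => PB PC.
    apply: filterS (filterI PB PC) => y [/= yB yC].
    by rewrite setIUr yB yC setU0.
  - move=> x [Lx Lix]; have Kx : ~ K x by move=> /KL.
    exists (connected_component (~` K) x).
      apply: open_nbhs_nbhs; split; first exact: connected_component_open.
      exact: connected_component_refl.
    (* The ultrafilter contains the complement of the component of [x]; points of it outside [K]
       have components disjoint from that one. *)
    have [Gx|] := in_ultra_setVsetC (connected_component (~` K) x) GU.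
      by case: nG; exists x.
    rewrite /P; apply: filterS => y xy /=; rewrite -subset0 => z [yz xz].
    apply: xy.
    by apply: connected_component_trans xz (connected_component_sym yz).
rewrite /P in PF; have [y [/= yF Ly]] := filter_ex (filterI PF (Gco _ cL)).
have Ky : ~ K y by move=> /KL/interior_subset.
pose C := connected_component (~` K) y.
have Cy : C y by exact: connected_component_refl.
have oC : open C by exact: connected_component_open.
have sepL : separated L^° (~` L).
  split; apply/disjoints_subset.
    rewrite setCK {2}(_ : L = closure L).
      exact: closureS (@interior_subset _ _).
    by apply/closure_id; exact: compact_closed.
  by rewrite -interiorC setCK.
(* A connected set missing the frontier lies on one side of it, and [y] is outside [L]. *)
have CL : C `<=` ~` L.
  have [|CLi|//] := connected_subset sepL _ (@component_connected _ (~` K) y).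
    move=> z yz; have [Lz|] := pselect (L z); last by right.
    left; apply: contrapT => Lz'.
    by have : set0 z by rewrite -yF.
  by have /interior_subset := CLi _ Cy.
(* A point outside [C] is either interior to [L], which misses [C], or outside [K], where its own
   component is open and disjoint from [C]. *)
have cC : closed C.
  rewrite -openC openE => z Cz; have [Liz|Liz] := pselect (L^° z).
    by apply: filterS Liz => w Lw /CL.
  have Kz : ~ K z by move=> /KL.
  have : nbhs z (connected_component (~` K) z).
    apply: open_nbhs_nbhs; split; first exact: connected_component_open.
    exact: connected_component_refl.
  apply: filterS => w zw Cw; apply: Cz.
  by apply: connected_component_trans Cw _; exact: connected_component_sym.
have CT : C = setT.
  by apply: cX; [exists y|exists C|exists C] => //; rewrite setTI.
by apply: nG; exists y => //; rewrite -/C CT; exact: filterT.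
Qed.

(** The selected components belong to [G], so any two meet; this makes the choice compatible with
    inclusion. *)
Lemma end_of_ultra (X : topologicalType) (G : set_system X) :
  hausdorff_space X -> locally_compact_connected X -> connected [set: X] ->
  UltraFilter G -> (forall L, compact L -> G (~` L)) ->
  exists e : ends X, forall K, G (val e K).
Proof.
move=> hX lX cX GU Gco; have GF := @ultra_proper _ _ GU.
have /choice[e eP] : forall K : compacts X, exists C,
    complement_components (val K) C /\ G C.
  move=> K; have cK : compact (val K) := set_mem (valP K).
  have [x Kx Gx] := ultra_component hX lX cX GU Gco cK.
  by exists (connected_component (~` val K) x); split=> //; exists x.
have ee : ends_set e.
  split=> [K|K L KL]; first by have [] := eP K.
  have [[x Kx <-] Gx] := eP K; have [[y Ly <-] Gy] := eP L.
  have LK : connected_component (~` val L) y `<=` ~` val K.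
    by move=> z /connected_component_sub Lz /KL.
  apply: connected_component_subset LK _; first exact: component_connected.
  exact: filter_ex (filterI Gx Gy).
by exists (exist _ e (mem_set ee)) => K; have [] := eP K.
Qed.

(** Transports compactness and connectedness of a segment to its subtype; off [A] the map takes the
    default value [a]. *)
Lemma set_typeT_image (X : topologicalType) (A : set X) (a : A) :
  exists2 g : X -> A, {within A, continuous g} & g @` A = setT.
Proof.
exists ('valL_a idfun).
  by apply/subspace_valL_continuousP' => b; exact: cvg_id.
apply/seteqP; split=> // b _; exists (set_val b); first exact: set_valP.
exact: (congr1 (@^~ b) (valLK a idfun)).
Qed.

(** * Components selected by an end *)

Section ends_elements.
Variables (X : topologicalType) (e : ends X).
Implicit Types K L : compacts X.

Lemma endP K :
  exists2 x, ~ val K x & val e K = connected_component (~` val K) x.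
Proof.
by have [/(_ K)[x Kx <-] _] := set_mem (valP e); exists x.
Qed.

Lemma end_nonempty K : val e K !=set0.
Proof.
by have [x Kx ->] := endP K; exists x; exact: connected_component_refl.
Qed.

Lemma end_connected K : connected (val e K).
Proof. by have [x _ ->] := endP K; exact: component_connected. Qed.

Lemma end_sub K : val e K `<=` ~` val K.
Proof. by have [x _ ->] := endP K; exact: connected_component_sub. Qed.

Lemma end_mono K L : val K `<=` val L -> val e L `<=` val e K.
Proof. by have [_] := set_mem (valP e); apply. Qed.

End ends_elements.

Definition compactsU (X : topologicalType) (K L : compacts X) : compacts X :=
  exist _ (val K `|` val L)
    (mem_set (compactU (set_mem (valP K)) (set_mem (valP L)))).

Lemma complement_components_meet (X : topologicalType) (K D D' : set X) :
  complement_components K D -> complement_components K D' ->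
  D `&` D' !=set0 -> D = D'.
Proof.
move=> [x Kx <-] [x' Kx' <-] [y [xy x'y]].
by rewrite (same_connected_component xy) (same_connected_component x'y).
Qed.

(** * Quotient map, tubes and shadows in the mapping torus *)

Section mapping_torus_ends.
Variables (R : realType) (S : topologicalType) (f : homeo S S).
Local Notation I := (unit_interval R).
Local Notation M := (mapping_torus R f).

Definition torus_pi (p : cylinder R S) : M := (\pi_M p)%qT.

Lemma torus_pi_surj (m : M) : exists p, m = torus_pi p.
Proof. by exists (repr m); rewrite /torus_pi reprK. Qed.

Lemma torus_pi_continuous : continuous torus_pi.
Proof. exact: pi_continuous. Qed.

Lemma torus_pi_eq (p p' : cylinder R S) : torus_pi p = torus_pi p' <->
  clos_refl_sym_trans _ (mapping_torus_glue f) p p'.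
Proof.
split=> [/(@eqquotP _ (mapping_torus_equiv R f))/asboolP//|pp'].
by apply/(@eqquotP _ (mapping_torus_equiv R f))/asboolP.
Qed.

Lemma unit_interval_mem0 : (0 : R) \in (`[0, 1]%classic : set R).
Proof. by rewrite inE/= in_itv/= lexx ler01. Qed.

Lemma unit_interval_mem1 : (1 : R) \in (`[0, 1]%classic : set R).
Proof. by rewrite inE/= in_itv/= lexx ler01. Qed.

Definition itv0 : I := exist _ 0 unit_interval_mem0.
Definition itv1 : I := exist _ 1 unit_interval_mem1.

Lemma unit_interval_bounds (t : I) : 0 <= set_val t <= 1.
Proof. by have := set_valP t; rewrite /= in_itv. Qed.

Lemma torus_pi_glue (y : S) : torus_pi (y, itv1) = torus_pi (f y, itv0).
Proof. by apply/torus_pi_eq; apply: rst_step; split. Qed.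

Lemma unit_interval_connected : connected [set: I].
Proof.
have [g cg <-] := set_typeT_image itv0.
by apply: connected_continuous_connected => //; exact: segment_connected.
Qed.

Lemma unit_interval_compact : compact [set: I].
Proof.
have [g cg <-] := set_typeT_image itv0.
by apply: continuous_compact => //; exact: segment_compact.
Qed.

Definition tube (A : set S) : set M := torus_pi @` (A `*` setT).

Lemma tube_connected (A : set S) : connected A -> connected (tube A).
Proof.
move=> cA; apply: connected_continuous_connected.
  by apply: connected_setX => //; exact: unit_interval_connected.
by apply: continuous_subspaceT; exact: torus_pi_continuous.
Qed.

Lemma tube_compact (A : set S) : compact A -> compact (tube A).
Proof.
move=> cA; apply: continuous_compact.
  by apply: continuous_subspaceT; exact: torus_pi_continuous.
by apply: compact_setX => //; exact: unit_interval_compact.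
Qed.

(** The projection to [S] of the preimage of [K] in the cylinder; a point of [K] on the seam
    contributes both [y] and [f y]. *)
Definition shadow (K : set M) : set S :=
  [set y | exists t, K (torus_pi (y, t))].

Lemma tube_shadowC (K : set M) (A : set S) :
  A `<=` ~` shadow K -> tube A `<=` ~` K.
Proof. by move=> AK _ [[y t] [/= Ay _] <-] Kyt; apply: (AK y Ay); exists t. Qed.

(* Saturated because the tests [V p.1] at height 0 and [V (f p.1)] at height 1
   agree on glued points. *)
Definition saturated_box (V : set S) : set (cylinder R S) :=
  [set p | set_val p.2 < 1 /\ V p.1 \/ 0 < set_val p.2 /\ V (f p.1)].

Lemma saturated_boxP (V : set S) (p p' : cylinder R S) :
  torus_pi p = torus_pi p' -> saturated_box V p <-> saturated_box V p'.
Proof.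
move=> /torus_pi_eq.
elim=> {p p'} [[y s] [y' s']|p|p p' _ IH|p p' p'' _ IH _ IH'] //.
- rewrite /mapping_torus_glue /saturated_box /= => -[-> -> ->].
  by rewrite !ltxx ltr01; split=> [[[]//|[_ ?]]|[[_ ?]|[]//]]; [left|right].
- by split=> ?; apply/IH.
- by split=> [/IH/IH'|/IH'/IH].
Qed.

(** By saturation the preimage of the image is the box itself, which is open in the cylinder. *)
Lemma torus_open (V : set S) : open V -> open (torus_pi @` saturated_box V).
Proof.
move=> oV; suff oO : open (saturated_box V).
  suff OE : torus_pi @^-1` (torus_pi @` saturated_box V) = saturated_box V.
    by rewrite -OE in oO.
  apply/seteqP; split=> [p [p' Op' pp']|p Op]; last by exists p.
  exact/(saturated_boxP V pp').
have co (X : topologicalType) (g : cylinder R S -> X) (A : set X) :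
  continuous g -> open A -> open (g @^-1` A) by move=> /continuousP; apply.
have fst_c : continuous (fst : cylinder R S -> S).
  by move=> [y t]; exact: cvg_fst.
have snd_c : continuous (set_val \o snd : cylinder R S -> R).
  move=> p; apply: continuous_comp; first exact: cvg_snd.
  exact: initial_continuous.
have f_c : continuous (f \o fst : cylinder R S -> S).
  by move=> p; apply: continuous_comp; [exact: fst_c|exact: homeo_continuous].
have -> : saturated_box V =
    ((set_val \o snd) @^-1` [set s : R | s < 1] `&` fst @^-1` V) `|`
    ((set_val \o snd) @^-1` [set s : R | 0 < s] `&` (f \o fst) @^-1` V) by [].
by apply: openU; apply: openI; apply: co.
Qed.

(** The shadow of a box over [N] lies in the union of [N] and its preimage under [f]; compactness
    induction combines these local bounds. *)
Lemma compact_shadow (K : set M) : locally_compact_connected S -> compact K ->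
  exists2 L, compact L & shadow K `<=` L.
Proof.
move=> lS cK.
apply: (compact_local_ind
  (P := fun K => exists2 L, compact L & shadow K `<=` L) cK).
- by exists set0; [exact: compact0|move=> y []].
- move=> B C BC [L cL CL]; exists L => //; apply: subset_trans CL.
  by move=> y [t /BC]; exists t.
- move=> B C [L cL BL] [N cN CN]; exists (L `|` N); first exact: compactU.
  by move=> y [t [Bt|Ct]]; [left; apply: BL|right; apply: CN]; exists t.
move=> m _; have [[y t] ->] := torus_pi_surj m.
(* At height 1 only the second test of the box can hold, so the box is built around [f y]. *)
pose z := if set_val t < 1 then y else f y.
have [N [Nz cN _ _]] := lS z setT filterT.
have oN : open N^° by exact: open_interior.
eexists; first apply: open_nbhs_nbhs; first split; first exact: (torus_open oN).
  exists (y, t) => //=; move: Nz; rewrite /z.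
  have /andP[t0 t1] := unit_interval_bounds t.
  case: ltP => [t_lt1 Ny|t_ge1 Nfy]; [left|right]; split=> //.
  exact: lt_le_trans t_ge1.
exists (N `|` f @^-1` N).
  by apply: compactU => //; exact: homeo_preimage_compact.
move=> x [s [p Op px]].
by have [[_ Nx]|[_ Nx]] := (saturated_boxP _ px).1 Op; [left|right];
  apply: (interior_subset Nx).
Qed.

(** * Components of the torus absorbing ends of the surface *)

Definition absorbs (K D : set M) (z : ends S) :=
  exists2 L : compacts S, shadow K `<=` val L & tube (val z L) `<=` D.

(** Both tubes contain the tube of [z] at the union of the two compact sets. Allowing [K] and [K']
    to differ serves both uniqueness of the absorbing component and compatibility under
    inclusion. *)
Lemma absorbs_meet (K K' D D' : set M) (z : ends S) :
  absorbs K D z -> absorbs K' D' z -> D `&` D' !=set0.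
Proof.
move=> [L KL LD] [L' KL' LD'].
have [y zy] := end_nonempty z (compactsU L L').
have zLy : val z L y by apply: end_mono zy; exact: subsetUl.
have zL'y : val z L' y by apply: end_mono zy; exact: subsetUr.
by exists (torus_pi (y, itv0)); split; [apply: LD|apply: LD']; exists (y, itv0).
Qed.

Lemma absorbs_ex (K : set M) (z : ends S) :
  locally_compact_connected S -> compact K ->
  exists2 D, complement_components K D & absorbs K D z.
Proof.
move=> lS cK; have [L cL KL] := compact_shadow lS cK.
pose L' : compacts S := exist _ L (mem_set cL).
have tK : tube (val z L') `<=` ~` K.
  by apply: tube_shadowC => y /end_sub Ly /KL.
have [y zy] := end_nonempty z L'.
have ty : tube (val z L') (torus_pi (y, itv0)) by exists (y, itv0).
exists (connected_component (~` K) (torus_pi (y, itv0))).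
  by exists (torus_pi (y, itv0)) => //; exact: tK.
exists L' => //; apply: connected_component_max ty tK _.
exact: tube_connected (@end_connected _ z L').
Qed.

Lemma absorbs_ends_map (K D : set M) (z : ends S) :
  locally_compact_connected S -> compact K -> complement_components K D ->
  absorbs K D (ends_map f z) <-> absorbs K D z.
Proof.
move=> lS cK KD.
(* Exactly one component absorbs an end, so one implication yields the converse. *)
suff H E : complement_components K E -> absorbs K E z ->
    absorbs K E (ends_map f z).
  split=> [Dfz|]; last exact: H.
  have [E KE Ez] := absorbs_ex z lS cK.
  suff -> : D = E by [].
  exact: complement_components_meet KD KE (absorbs_meet Dfz (H _ KE Ez)).
move=> {D KD} KE Ez; have [E' KE' E'fz] := absorbs_ex (ends_map f z) lS cK.
suff -> : E = E' by [].
apply: (complement_components_meet KE KE').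
have [L KL LE] := Ez; have [L' KL' LE'] := E'fz.
(* Here [y] is far enough out for [L], and [f y] for [L']; the point where [(y, 1)] is glued to
   [(f y, 0)] is then common to [E] and [E']. *)
have [y zy] := end_nonempty z (compactsU L (compacts_preimage f L')).
exists (torus_pi (y, itv1)); split.
  apply: LE; exists (y, itv1) => //; split=> //=.
  by apply: end_mono zy; exact: subsetUl.
rewrite torus_pi_glue; apply: LE'; exists (f y, itv0) => //; split=> //=.
by exists y => //; apply: end_mono zy; exact: subsetUr.
Qed.

Lemma absorbs_homeo_iter (K D : set M) (z : ends S) (n : int) :
  locally_compact_connected S -> compact K -> complement_components K D ->
  absorbs K D (homeo_iter (ends_homeo f) n z) <-> absorbs K D z.
Proof.
move=> lS cK KD; have fP w := absorbs_ends_map w lS cK KD.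
have fVP w : absorbs K D (homeo_inv (ends_homeo f) w) <-> absorbs K D w.
  rewrite -[in X in _ <-> X](homeoVK (ends_homeo f) w).
  exact: iff_sym (fP _).
case: n => n /=; last first.
  (* [Negz n] stands for [n.+1] inverse steps, so one is peeled off before the induction. *)
  by rewrite fVP; elim: n => //= n <-; exact: fVP.
by elim: n => //= n <-; exact: fP.
Qed.

(** The witness [L] involves [z] only through [val z L], which all nearby ends share. The orbit
    meets this neighbourhood, and invariance carries absorption back to [x]. *)
Lemma absorbs_closure (K D : set M) (x z : ends S) :
  locally_compact_connected S -> compact K -> complement_components K D ->
  closure (homeo_orbit (ends_homeo f) x) z -> absorbs K D z -> absorbs K D x.
Proof.
move=> lS cK KD cz [L KL LD].
have [_ [[n _ <-] xz]] := cz _ (near_ends z L).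
by apply/(absorbs_homeo_iter x n lS cK KD); exists L => //; rewrite xz.
Qed.

Lemma end_absorbs (K : compacts M) (e : ends M) :
  hausdorff_space S -> locally_compact_connected S -> connected [set: S] ->
  exists z, absorbs (val K) (val e K) z.
Proof.
move=> hS lS cS.
pose F := filter_from setT (fun N : compacts M => shadow (val e N)).
have FF : ProperFilter F.
  apply: filter_from_proper.
    apply: filter_fromT_filter; first by exists K.
    move=> N N'; exists (compactsU N N') => y [t et].
    by split; exists t; apply: end_mono et; [exact: subsetUl|exact: subsetUr].
  move=> N _; have [m em] := end_nonempty e N.
  have [[y t] mE] := torus_pi_surj m.
  by exists y; exists t; rewrite -mE.
have [G [GU FG]] := ultraFilterLemma FF.
have [|z Gz] := end_of_ultra hS lS cS GU.
  move=> L cL.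
  (* With this [N], [val e N] misses every fibre over [L], so its shadow misses [L]. *)
  pose N : compacts M := exist _ (tube L) (mem_set (tube_compact cL)).
  apply: FG; exists N => // y [t /end_sub tL] Ly.
  by apply: tL; exists (y, t).
have cK : compact (val K) := set_mem (valP K).
have [L cL KL] := compact_shadow lS cK.
pose L' : compacts S := exist _ L (mem_set cL).
exists z, L' => //.
have [m Km eE] := endP e K; rewrite eE.
apply: connected_component_subset.
- exact: tube_connected (@end_connected _ z L').
- by apply: tube_shadowC => y /end_sub Ly /KL.
(* Two members of [G] meet: some fibre over [val z L'] meets [val e K], which forces the whole
   connected tube into that component. *)
have GK : G (shadow (val e K)) by apply: FG; exists K.
have [y [zy [t et]]] := filter_ex (filterI (Gz L') GK).
by exists (torus_pi (y, t)); split; [rewrite -eE|exists (y, t)].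
Qed.

End mapping_torus_ends.

Theorem theorem1p3 (R : realType) (S : topologicalType)
    (surfS : surface R S) (connS : connected [set: S]) (f : homeo S S)
    (denseS : exists x : ends S,
      closure (homeo_orbit (ends_homeo f) x) = [set: ends S]) :
  exists e : ends (mapping_torus R f),
    forall e' : ends (mapping_torus R f), e' = e.
Proof.
have lS := surface_locally_compact_connected surfS.
have [hS _ _] := surfS.
have [x dx] := denseS.
have cK (K : compacts (mapping_torus R f)) : compact (val K).
  exact: set_mem (valP K).
(* The candidate end picks the component absorbing [x]. *)
have /choice[e eP] : forall K : compacts (mapping_torus R f), exists D,
    complement_components (val K) D /\ absorbs (val K) D x.
  by move=> K; have [D KD Dx] := absorbs_ex x lS (cK K); exists D.
have ee : ends_set e.
  split=> [K|K L KL]; first by have [] := eP K.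
  have [[m Km emK] Kx] := eP K; have [[n Ln enL] Lx] := eP L.
  (* [e L] is connected, avoids [K], and meets [e K] because both absorb [x]. *)
  have LK : e L `<=` ~` val K.
    by rewrite -enL => p /connected_component_sub Lp /KL.
  rewrite -emK; apply: connected_component_subset LK _.
    by rewrite -enL; exact: component_connected.
  by rewrite emK; exact: absorbs_meet Kx Lx.
exists (exist _ e (mem_set ee)) => e'.
apply: val_inj; apply: functional_extensionality_dep => K /=.
have [KD Dx] := eP K.
have KD' : complement_components (val K) (val e' K).
  by have [m Km ->] := endP e' K; exists m.
(* [z] may depend on [K]; density places it in the closure of the orbit, so [val e' K] absorbs [x],
   as [e K] does. *)
have [z ez] := end_absorbs K e' hS lS connS.
have cz : closure (homeo_orbit (ends_homeo f) x) z by rewrite dx.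
have ex := absorbs_closure lS (cK K) KD' cz ez.
exact: complement_components_meet KD' KD (absorbs_meet ex Dx).
Qed.
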